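(* Consider the scalar stochastic problem of the context with constant control coefficient $g$ and unit noise variance, and suppose the solution $J(t,x)$ of the stochastic HJB equation is sufficiently smooth. Let $u(t,x)$ be the optimal policy and let $(\bar x_t,\bar u_t)$ be the nominal (noise-free) trajectory under it from some $x_0$, i.e. $\dot{\bar x}_t=f(\bar x_t)+g\bar u_t$ with $\bar u_t=u(t,\bar x_t)$. With $\delta x_t=x_t-\bar x_t$, expand $$J(t,x_t)=\bar J_t+K_t^1\,\delta x_t+\tfrac12K_t^2\,\delta x_t^2+\cdots,$$ where $K_t^i=\partial^iJ/\partial x^i(t,\bar x_t)$. Then $$-\dot{\bar J}_t=\bar l_t-\frac gr\Big(\frac{gK_t^1}{2}+r\bar u_t\Big)K_t^1+\frac{\epsilon^2}{2}K_t^2,$$ $$-\dot K_t^1=L_t^1+F_t^1K_t^1-\frac gr\big(gK_t^1+r\bar u_t\big)K_t^2+\frac{\epsilon^2}{2}K_t^3,$$ $$-\dot K_t^2=L_t^2+2F_t^1K_t^2+F_t^2K_t^1-\frac{g^2}{r}(K_t^2)^2-\frac gr\big(gK_t^1+r\bar u_t\big)K_t^3+\frac{\epsilon^2}{2}K_t^4.$$ Thus, for $\epsilon\neq0$, the evolution equations of the lower-order coefficients involve higher-order coefficients.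
   Context: Scalar stochastic problem: minimize $\mathbb{E}\left[\int_0^T\big(l(x_t)+\frac12ru_t^2\big)\,dt+c_T(x_T)\right]$ over feedback policies, with $r>0$, subject to $dx=(f(x)+gu)\,dt+\epsilon\,dw$, where $w$ is a standard scalar Wiener process. The functions $f,l,c_T$ are five times continuously differentiable. The stochastic HJB equation is $-\frac{\partial J}{\partial t}=\min_u\{l(x)+\frac12ru^2+(f(x)+gu)\frac{\partial J}{\partial x}\}+\frac{\epsilon^2}{2}\frac{\partial^2J}{\partial x^2}$ with $J(T,x)=c_T(x)$. Notation: $\bar l_t=l(\bar x_t)$ and $\bar J_t=J(t,\bar x_t)$; $F_t^i$ and $L_t^i$ are the Taylor coefficients of $f$ and $l$ about $\bar x_t$, i.e. $f(x_t)=f(\bar x_t)+F_t^1\delta x_t+\frac12F_t^2\delta x_t^2+\cdots$ and $l(x_t)=l(\bar x_t)+L_t^1\delta x_t+\frac12L_t^2\delta x_t^2+\cdots$. A dot denotes the total derivative in $t$ along the nominal trajectory. *)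

(* Defs.v *)
From Stdlib Require Import Reals.
From Coquelicot Require Import Coquelicot.
Open Scope R_scope.

Definition C_n (n : nat) (h : R -> R) : Prop :=
  forall (k : nat) (x : R), (k <= n)%nat ->
    ex_derive_n h k x /\ continuous (Derive_n h k) x.

(* i-th partial derivative in the state, of a function of (time, state). *)
Definition dx (i : nat) (J : R -> R -> R) (t x : R) : R := Derive_n (J t) i x.

Definition dt (J : R -> R -> R) (t x : R) : R := Derive (fun s => J s x) t.

(* The quantity minimised over the control v in the HJB equation; p stands for
   the first state derivative of J. *)
Definition hamiltonian (f l : R -> R) (g r : R) (x p v : R) : R :=
  l x + / 2 * r * v ^ 2 + (f x + g * v) * p.

Definition is_min (h : R -> R) (m : R) : Prop :=
  (exists v, h v = m) /\ (forall v, m <= h v).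

Definition closed_strip (T : R) (p : R * R) : Prop := 0 <= fst p <= T.

(* Classical solution of the terminal value problem
     - J_t = min_v (l + r v^2 / 2 + (f + g v) J_x) + eps^2 / 2 J_xx,
     J(T, x) = cT x.
   Continuity up to t = T is what ties the terminal value to the equation,
   which is imposed at interior times only. *)
Definition HJB_solution (f l cT : R -> R) (g r eps T : R) (J : R -> R -> R)
  : Prop :=
  (forall t x, 0 < t < T ->
     exists m, is_min (hamiltonian f l g r x (dx 1 J t x)) m /\
               - dt J t x = m + eps ^ 2 / 2 * dx 2 J t x) /\
  (forall x, J T x = cT x) /\
  continuous_on (closed_strip T) (fun p : R * R => J (fst p) (snd p)).

(* Dynamic-programming notion of optimality: the feedback attains the minimum
   in the HJB equation at every time and state. *)
Definition optimal_policy (f l : R -> R) (g r T : R) (J u : R -> R -> R)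
  : Prop :=
  forall t x, 0 < t < T ->
    is_min (hamiltonian f l g r x (dx 1 J t x))
           (hamiltonian f l g r x (dx 1 J t x) (u t x)).

(* The noise-free closed-loop trajectory issued from x0. *)
Definition nominal_trajectory (f : R -> R) (g T x0 : R) (u : R -> R -> R)
    (xbar : R -> R) : Prop :=
  xbar 0 = x0 /\
  continuous_on (fun t => 0 <= t <= T) xbar /\
  (forall t, 0 < t < T ->
     is_derive xbar t (f (xbar t) + g * u t (xbar t))).

(* h(xbar + d) = h(xbar) + c 1 * d + c 2 * d^2 / 2 + ... : the coefficients are
   normalised by the factorials, hence are the derivatives. *)
Definition taylor (h : R -> R) (xb : R) (i : nat) : R := Derive_n h i xb.

(* Right-hand sides of the evolution equations of Jbar, K^1 and K^2, as
   functions of the whole family k = (k i) of expansion coefficients of J, so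
   that one can ask which coefficients they involve. *)
Definition rhs_J (g r eps lbar ubar : R) (k : nat -> R) : R :=
  lbar - g / r * (g * k 1%nat / 2 + r * ubar) * k 1%nat
  + eps ^ 2 / 2 * k 2%nat.

Definition rhs_K1 (g r eps ubar : R) (L F k : nat -> R) : R :=
  L 1%nat + F 1%nat * k 1%nat
  - g / r * (g * k 1%nat + r * ubar) * k 2%nat
  + eps ^ 2 / 2 * k 3%nat.

Definition rhs_K2 (g r eps ubar : R) (L F k : nat -> R) : R :=
  L 2%nat + 2 * F 1%nat * k 2%nat + F 2%nat * k 1%nat
  - g ^ 2 / r * (k 2%nat) ^ 2
  - g / r * (g * k 1%nat + r * ubar) * k 3%nat
  + eps ^ 2 / 2 * k 4%nat.

(* Phi genuinely depends, at the family k, on the coefficient of index i.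
   Asking this at the actual coefficients matters: there g * k 1 + r * ubar
   vanishes, so a coefficient entering only through that factor, like k 2 in
   rhs_K1, does not count as involved. *)
Definition involves (Phi : (nat -> R) -> R) (k : nat -> R) (i : nat) : Prop :=
  exists k' : nat -> R,
    (forall j, j <> i -> k' j = k j) /\ Phi k' <> Phi k.

(* Main.v *)
Require Import Defs.
From Stdlib Require Import Reals Lra Lia.
From Coquelicot Require Import Coquelicot.
Open Scope R_scope.

(** The minimiser of the Hamiltonian is u = - g J_x / r, so the HJB equation is
    the closed semilinear equation
      - J_t = l + f J_x - g^2 / (2 r) J_x^2 + eps^2 / 2 J_xx.
    Differentiating it in x up to twice gives J_tx and J_txx; since J is C^4
    these are also the time derivatives of J_x and J_xx, and the chain rule
    along the nominal trajectory gives the evolution equations. *)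

(** Completing the square: the cost excess of [v] over the candidate is
    [r / 2 * (v + g * p / r) ^ 2], and minimality of [v] forces it to be nonpositive. *)
Lemma hamiltonian_argmin (f l : R -> R) (g r x p v : R) (Hr : 0 < r) :
  is_min (hamiltonian f l g r x p) (hamiltonian f l g r x p v) ->
  v = - (g * p / r).
Proof.
  intros [_ Hmin].
  specialize (Hmin (- (g * p / r))).
  assert (Hsq : hamiltonian f l g r x p v
                - hamiltonian f l g r x p (- (g * p / r))
                = r * (v + g * p / r) ^ 2 / 2).
  { unfold hamiltonian. field. lra. }
  assert (Hw : v + g * p / r = 0).
  { destruct (Req_dec (v + g * p / r) 0) as [| Hne]; [assumption | exfalso].
    generalize (Rmult_lt_0_compat _ _ Hr (pow2_gt_0 _ Hne)). lra. }
  lra.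
Qed.

Lemma is_min_unique (h : R -> R) (m m' : R) :
  is_min h m -> is_min h m' -> m = m'.
Proof.
  intros [[v Hv] Hm] [[v' Hv'] Hm'].
  apply Rle_antisym.
  - rewrite <- Hv'. apply Hm.
  - rewrite <- Hv. apply Hm'.
Qed.

Lemma HJB_closed_form (f l cT : R -> R) (g r eps T : R) (J u : R -> R -> R)
    (Hr : 0 < r) (HJ : HJB_solution f l cT g r eps T J)
    (Hu : optimal_policy f l g r T J u) (t x : R) (Ht : 0 < t < T) :
  dt J t x =
  - (l x + f x * dx 1 J t x - g ^ 2 / (2 * r) * dx 1 J t x ^ 2
     + eps ^ 2 / 2 * dx 2 J t x).
Proof.
  destruct HJ as [HJ _].
  destruct (HJ t x Ht) as [m [Hm Heq]].
  (* The minimum [m] in the HJB equation is only existential; uniqueness identifies it with the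
     Hamiltonian at [u t x], whose value is then explicit. *)
  rewrite (is_min_unique _ _ _ Hm (Hu t x Ht)) in Heq.
  rewrite (hamiltonian_argmin _ _ _ _ _ _ _ Hr (Hu t x Ht)) in Heq.
  rewrite <- (Ropp_involutive (dt J t x)), Heq.
  unfold hamiltonian. field. lra.
Qed.

(** The open strip contains the box of radius [Rmin t (T - t)] around the point. This turns
    hypotheses on interior times into the local ones of two-variable calculus. *)
Lemma strip_locally_2d (T t x : R) (P : R -> R -> Prop) :
  0 < t < T -> (forall s y, 0 < s < T -> P s y) -> locally_2d P t x.
Proof.
  intros Ht HP.
  assert (Hd : 0 < Rmin t (T - t)) by (apply Rmin_pos; lra).
  exists (mkposreal _ Hd). intros s y Hs _. apply HP.
  simpl in Hs. apply Rabs_lt_between in Hs.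
  generalize (Rmin_l t (T - t)) (Rmin_r t (T - t)). lra.
Qed.

Lemma is_derive_eq (h : R -> R) (x a b : R) :
  is_derive h x a -> a = b -> is_derive h x b.
Proof. now intros H <-. Qed.

(** The chain rule along [s => (s, xbar s)] needs joint differentiability of [G]. It follows from a
    time partial that exists nearby and is continuous at the point, together with a state partial at
    the point itself. *)
Lemma is_derive_along (G : R -> R -> R) (xbar : R -> R) (t v : R) :
  locally_2d (fun s y => ex_diff_n G 1 s y) t (xbar t) ->
  is_derive xbar t v ->
  is_derive (fun s => G s (xbar s)) t
    (dt G t (xbar t) + dx 1 G t (xbar t) * v).
Proof.
  intros HG Hx.
  assert (HGt := locally_2d_singleton _ _ _ HG).
  destruct HGt as (_ & _ & Hy & [Hc _] & _).
  assert (Hd : differentiable_pt_lim G t (xbar t)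
                 (dt G t (xbar t)) (dx 1 G t (xbar t))).
  { apply filterdiff_differentiable_pt_lim.
    apply (is_derive_filterdiff G t (xbar t) (dt G) (dx 1 G t (xbar t))).
    - apply (proj1 (locally_2d_locally
        (fun s y => is_derive (fun z => G z y) s (dt G s y)) t (xbar t))).
      apply locally_2d_impl with (2 := HG). apply locally_2d_forall.
      intros s y (_ & Hs & _). apply Derive_correct, Hs.
    - apply Derive_correct, Hy.
    - apply continuity_2d_pt_filterlim, Hc. }
  replace (dt G t (xbar t) + dx 1 G t (xbar t) * v)
    with (dt G t (xbar t) * 1 + dx 1 G t (xbar t) * v) by ring.
  apply is_derive_Reals.
  apply (derivable_pt_lim_comp_2d G (fun s => s) xbar); trivial.
  - apply derivable_pt_lim_id.
  - apply is_derive_Reals, Hx.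
Qed.

Lemma is_derive_dx (J : R -> R -> R) (n k : nat) (t x : R) :
  (k < n)%nat -> ex_diff_n J n t x ->
  is_derive (dx k J t) x (dx (S k) J t x).
Proof.
  intros Hk HJ. apply Derive_correct.
  exact (ex_diff_n_ex_deriv_inf_2 n 0 k Hk J t x HJ).
Qed.

Lemma is_derive_C_n (h : R -> R) (n k : nat) (x : R) :
  (k < n)%nat -> C_n n h -> is_derive (Derive_n h k) x (Derive_n h (S k) x).
Proof.
  intros Hk Hh. apply Derive_correct.
  exact (proj1 (Hh (S k) x Hk)).
Qed.

(** By Schwarz, the time derivative of [dx k J] is the [k]-th state derivative of [dt J], which the
    HJB equation makes explicit; the rest is the chain rule. *)
Lemma is_derive_dx_along (J : R -> R -> R) (T : R) (n k : nat)
    (xbar : R -> R) (t v : R) :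
  (k < n)%nat -> (forall s y, 0 < s < T -> ex_diff_n J n s y) ->
  0 < t < T -> is_derive xbar t v ->
  is_derive (fun s => dx k J s (xbar s)) t
    (Derive_n (dt J t) k (xbar t) + dx (S k) J t (xbar t) * v).
Proof.
  intros Hk HJ Ht Hx.
  assert (Hsw : dt (dx k J) t (xbar t) = Derive_n (dt J t) k (xbar t)).
  { apply (Derive_partial_derive_aux1 k J t (xbar t)).
    apply strip_locally_2d with (1 := Ht). intros s y Hs.
    apply (ex_diff_n_m n (S k)); [lia | auto]. }
  rewrite <- Hsw.
  apply (is_derive_along (dx k J)); trivial.
  apply strip_locally_2d with (1 := Ht). intros s y Hs.
  (* The [k] state derivatives use up [k] orders of smoothness; [k < n] leaves the one that the
     chain rule requires. *)
  apply (ex_diff_n_m (n - k) 1); [lia |].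
  apply (ex_diff_n_deriv n 0 k); [simpl; lia | auto].
Qed.

Lemma Derive_dt_HJB
    (f l cT : R -> R) (g r eps T : R)
    (J u : R -> R -> R) (Hr : 0 < r) (Hf : C_n 2 f) (Hl : C_n 2 l)
    (HJ : HJB_solution f l cT g r eps T J)
    (HJsmooth : forall t x, 0 < t < T -> ex_diff_n J 4 t x)
    (Hu : optimal_policy f l g r T J u) (t x : R) (Ht : 0 < t < T) :
  Derive (dt J t) x =
  - (Derive_n l 1 x + Derive_n f 1 x * dx 1 J t x + f x * dx 2 J t x
     - g ^ 2 / r * dx 1 J t x * dx 2 J t x + eps ^ 2 / 2 * dx 3 J t x).
Proof.
  (* At fixed [t] the closed form holds for every state, so it is an identity between functions of
     [y] and may be differentiated. *)
  rewrite (Derive_ext (dt J t) _ x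
             (fun y => HJB_closed_form f l cT g r eps T J u Hr HJ Hu t y Ht)).
  apply is_derive_unique.
  assert (D1 := is_derive_dx J 4 1 t x ltac:(lia) (HJsmooth t x Ht)).
  assert (D2 := is_derive_dx J 4 2 t x ltac:(lia) (HJsmooth t x Ht)).
  assert (Df := is_derive_C_n f 2 0 x ltac:(lia) Hf).
  assert (Dl := is_derive_C_n l 2 0 x ltac:(lia) Hl).
  change (Derive_n f 0) with f in Df. change (Derive_n l 0) with l in Dl.
  (* Made opaque, the derivatives become atoms for [auto_derive]; their own derivatives come from
     [D1], [D2], [Df] and [Dl]. *)
  set (p := dx 1 J t) in *. set (q := dx 2 J t) in *.
  set (w := dx 3 J t) in *. clearbody p q w.
  auto_derive.
  - repeat split; try (eexists; eassumption).
  - rewrite (is_derive_unique (fun y : R => p y) x _ D1),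
      (is_derive_unique (fun y : R => q y) x _ D2),
      (is_derive_unique (fun y : R => f y) x _ Df),
      (is_derive_unique (fun y : R => l y) x _ Dl).
    field. lra.
Qed.

Lemma Derive_2_dt_HJB
    (f l cT : R -> R) (g r eps T : R)
    (J u : R -> R -> R) (Hr : 0 < r) (Hf : C_n 2 f) (Hl : C_n 2 l)
    (HJ : HJB_solution f l cT g r eps T J)
    (HJsmooth : forall t x, 0 < t < T -> ex_diff_n J 4 t x)
    (Hu : optimal_policy f l g r T J u) (t x : R) (Ht : 0 < t < T) :
  Derive_n (dt J t) 2 x =
  - (Derive_n l 2 x + Derive_n f 2 x * dx 1 J t x
     + 2 * Derive_n f 1 x * dx 2 J t x + f x * dx 3 J t x
     - g ^ 2 / r * (dx 2 J t x ^ 2 + dx 1 J t x * dx 3 J t x)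
     + eps ^ 2 / 2 * dx 4 J t x).
Proof.
  change (Derive_n (dt J t) 2 x) with (Derive (Derive (dt J t)) x).
  rewrite (Derive_ext _ _ x (fun y => Derive_dt_HJB f l cT g r eps T J u
                                  Hr Hf Hl HJ HJsmooth Hu t y Ht)).
  apply is_derive_unique.
  assert (D1 := is_derive_dx J 4 1 t x ltac:(lia) (HJsmooth t x Ht)).
  assert (D2 := is_derive_dx J 4 2 t x ltac:(lia) (HJsmooth t x Ht)).
  assert (D3 := is_derive_dx J 4 3 t x ltac:(lia) (HJsmooth t x Ht)).
  assert (Df := is_derive_C_n f 2 0 x ltac:(lia) Hf).
  assert (Df1 := is_derive_C_n f 2 1 x ltac:(lia) Hf).
  assert (Dl1 := is_derive_C_n l 2 1 x ltac:(lia) Hl).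
  change (Derive_n f 0) with f in Df.
  set (p := dx 1 J t) in *. set (q := dx 2 J t) in *.
  set (w := dx 3 J t) in *.
  set (f1 := Derive_n f 1) in *. set (l1 := Derive_n l 1) in *.
  clearbody p q w f1 l1.
  auto_derive.
  - repeat split; try (eexists; eassumption).
  - rewrite (is_derive_unique (fun y : R => p y) x _ D1),
      (is_derive_unique (fun y : R => q y) x _ D2),
      (is_derive_unique (fun y : R => w y) x _ D3),
      (is_derive_unique (fun y : R => f y) x _ Df),
      (is_derive_unique (fun y : R => f1 y) x _ Df1),
      (is_derive_unique (fun y : R => l1 y) x _ Dl1).
    field. lra.
Qed.

Lemma involves_of_increment (Phi : (nat -> R) -> R) (k : nat -> R) (i : nat) :
  Phi (fun j => if Nat.eqb j i then k j + 1 else k j) <> Phi k ->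
  involves Phi k i.
Proof.
  intros H. eexists. split; [| exact H].
  intros j Hj. simpl. apply Nat.eqb_neq in Hj. now rewrite Hj.
Qed.

Theorem mainTheorem7 (f l cT : R -> R) (g r eps T x0 : R)
    (J u : R -> R -> R) (xbar : R -> R)
    (Hr : 0 < r) (HT : 0 < T)
    (Hf : C_n 5 f) (Hl : C_n 5 l) (HcT : C_n 5 cT)
    (HJ : HJB_solution f l cT g r eps T J)
    (HJsmooth : forall t x, 0 < t < T -> ex_diff_n J 4 t x)
    (Hu : optimal_policy f l g r T J u)
    (Hxbar : nominal_trajectory f g T x0 u xbar) :
  let lbar := fun t : R => l (xbar t) in
  let ubar := fun t : R => u t (xbar t) in
  let Jbar := fun t : R => J t (xbar t) in
  let K := fun (t : R) (i : nat) => dx i J t (xbar t) in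
  let F := fun t : R => taylor f (xbar t) in
  let L := fun t : R => taylor l (xbar t) in
  (forall t, 0 < t < T ->
     is_derive Jbar t (- rhs_J g r eps (lbar t) (ubar t) (K t)) /\
     is_derive (fun s => K s 1%nat) t
       (- rhs_K1 g r eps (ubar t) (L t) (F t) (K t)) /\
     is_derive (fun s => K s 2%nat) t
       (- rhs_K2 g r eps (ubar t) (L t) (F t) (K t))) /\
  (eps <> 0 -> forall t, 0 < t < T ->
     involves (rhs_J g r eps (lbar t) (ubar t)) (K t) 2 /\
     involves (rhs_K1 g r eps (ubar t) (L t) (F t)) (K t) 3 /\
     involves (rhs_K2 g r eps (ubar t) (L t) (F t)) (K t) 4).
Proof.
  intros lbar ubar Jbar K F L.
  split.
  - intros t Ht.
    assert (Hx := proj2 (proj2 Hxbar) t Ht).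
    assert (Hub := hamiltonian_argmin _ _ _ _ _ _ _ Hr (Hu t (xbar t) Ht)).
    assert (Hf2 : C_n 2 f) by (intros k x Hk; apply Hf; lia).
    assert (Hl2 : C_n 2 l) by (intros k x Hk; apply Hl; lia).
    assert (D0 := is_derive_dx_along J T 4 0 xbar t _ ltac:(lia) HJsmooth Ht Hx).
    assert (D1 := is_derive_dx_along J T 4 1 xbar t _ ltac:(lia) HJsmooth Ht Hx).
    assert (D2 := is_derive_dx_along J T 4 2 xbar t _ ltac:(lia) HJsmooth Ht Hx).
    change (Derive_n (dt J t) 0 (xbar t)) with (dt J t (xbar t)) in D0.
    change (Derive_n (dt J t) 1 (xbar t)) with (Derive (dt J t) (xbar t)) in D1.
    rewrite (HJB_closed_form f l cT g r eps T J u Hr HJ Hu t _ Ht) in D0.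
    rewrite (Derive_dt_HJB f l cT g r eps T J u Hr Hf2 Hl2 HJ HJsmooth Hu t _ Ht)
      in D1.
    rewrite (Derive_2_dt_HJB f l cT g r eps T J u Hr Hf2 Hl2 HJ HJsmooth Hu t _ Ht)
      in D2.
    unfold rhs_J, rhs_K1, rhs_K2, lbar, ubar, F, L, taylor, K.
    rewrite Hub in *.
    split; [| split].
    (* In each equation the drift [f (xbar t)] of the transport term cancels the one coming from the
       HJB equation, and its control part [g * u] accounts for the [r * ubar] term. *)
    + apply (is_derive_eq _ _ _ _ D0). field. lra.
    + apply (is_derive_eq _ _ _ _ D1). field. lra.
    + apply (is_derive_eq _ _ _ _ D2). field. lra.
  - intros Heps t _.
    assert (0 < eps ^ 2) by (apply pow2_gt_0; assumption).
    (* The coefficient in question enters only through the diffusion term, so raising it by one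
       changes the right-hand side by [eps ^ 2 / 2], which is nonzero. *)
    repeat split; apply involves_of_increment;
      unfold rhs_J, rhs_K1, rhs_K2; simpl Nat.eqb; cbv iota; lra.
Qed.
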